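(* For any integer $n \geq 0$ (with $a$ denoting a nonnegative integer), $$v_2(B_n(3,0)) = \begin{cases} 0, & \text{if } n \equiv 0 \pmod{4}, \\ 1, & \text{if } n \equiv 5 \pmod{8}, \\ 3, & \text{if } n \equiv 9 \pmod{16}, \\ 1+ v_2 \big( a(a+1) \big), & \text{if } n = 4a + 2 \text{ and } v_2 \big( a(a+1) \big) \leq 4, \\ 0, & \text{if } n \equiv 3 \pmod{4}. \end{cases}$$ (No assertion is made for values of $n$ not covered by these cases.)
   Context: The sequence $\{B_n(3,0)\}_{n\geq 0}$ is defined by $B_n = B_{n-1}+B_{n-2}+B_{n-3}$ for $n \geq 3$, with $(B_0,B_1,B_2)=(1,0,0)$. $v_2$ denotes the 2-adic order (2-adic valuation), with the convention $v_2(0)=+\infty$. *)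

(* Defs.v *)
From mathcomp Require Import all_boot all_order all_algebra.
From mathcomp Require Export constructive_ereal.

Set Implicit Arguments.
Unset Strict Implicit.
Unset Printing Implicit Defensive.

Fixpoint B (n : nat) : nat :=
  match n with
  | 0 => 1
  | 1 => 0
  | 2 => 0
  | ((m.+1 as m1).+1 as m2).+1 => B m2 + B m1 + B m
  end.

(* [logn 2 0 = 0] in the library, so the value at 0 is set apart. *)
Definition v2 (m : nat) : \bar int :=
  if m == 0 then +oo%E else (Posz (logn 2 m))%:E.

(* Main.v *)
Require Import Defs.
From mathcomp Require Import all_boot all_order all_algebra.
From mathcomp Require Import constructive_ereal.
From mathcomp Require Import zify.

(** All the valuations asserted are at most 5, so they are determined by residues
    modulo 64.  Modulo 64 the sequence B is periodic with period 128, and what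
    remains is a check over one period. *)

(** Both sides say that [m] is an odd multiple of [2 ^ e], which fails for [m = 0]. A finite
    valuation thus becomes a test on a residue. *)
Lemma v2_eq (m e : nat) :
  v2 m = (Posz e)%:E <-> m %% 2 ^ e.+1 = 2 ^ e.
Proof.
have pow_gt0 k : 0 < 2 ^ k by rewrite expn_gt0.
rewrite /v2; case: posnP => [-> | m_gt0].
  by split=> //; rewrite mod0n => /esym/eqP; rewrite expn_eq0.
split=> [[<-] | m_mod].
  have [q odd_q def_m] := @pfactor_coprime 2 m isT m_gt0.
  rewrite coprime2n in odd_q.
  by rewrite {1}def_m expnS -muln_modl modn2 odd_q mul1n.
have dvd_e : 2 ^ e %| m.
  have := divn_eq m (2 ^ e.+1); rewrite m_mod => ->.
  by rewrite dvdn_add // dvdn_mull // dvdn_exp2l.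
have ndvd_e : ~~ (2 ^ e.+1 %| m) by rewrite /dvdn m_mod -lt0n.
move: dvd_e ndvd_e; rewrite !pfactor_dvdn // -leqNgt => le_e ge_e.
by congr (_ _)%:E; apply/eqP; rewrite eqn_leq ge_e.
Qed.

(** Reducing modulo 64 keeps the unary numbers small enough for [vm_compute]. *)
Definition B_step (s : nat * nat * nat) : nat * nat * nat :=
  (s.1.2, s.2, (s.2 + s.1.2 + s.1.1) %% 64).

Definition B_state (n : nat) : nat * nat * nat := iter n B_step (1, 0, 0).

Lemma B_stateE (n : nat) :
  B_state n = (B n %% 64, B n.+1 %% 64, B n.+2 %% 64).
Proof.
elim: n => [//|n IHn].
rewrite /B_state iterS -/(B_state n) IHn /B_step; congr (_, _, _).
by rewrite modnDmr -modnDml modnDm modnDml.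
Qed.

(** A state determines all later ones, so it suffices that the initial state recurs after 128
    steps. *)
Lemma B_state_mod128 (n : nat) : B_state n = B_state (n %% 128).
Proof.
rewrite {1}(divn_eq n 128); elim: (n %/ 128) => [//|q <-].
rewrite mulSnr addnAC /B_state iterD.
by have -> : iter 128 B_step (1, 0, 0) = (1, 0, 0) by vm_compute.
Qed.

(** For [e < 6] the modulus [2 ^ e.+1] divides 64, so the reduced state still decides the test of
    [v2_eq]. *)
Lemma v2_B (n e : nat) : e < 6 ->
  (B_state (n %% 128)).1.1 %% 2 ^ e.+1 = 2 ^ e -> v2 (B n) = (Posz e)%:E.
Proof.
move=> lt_e; rewrite -B_state_mod128 B_stateE /= (@modn_dvdm 64) => [/v2_eq//|].
by rewrite (@dvdn_exp2l 2 _ 6).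
Qed.

Lemma v2_B_class (n d r e : nat) : e < 6 -> d %| 128 ->
  all (fun i => (i %% d == r %% d) ==>
                ((B_state i).1.1 %% 2 ^ e.+1 == 2 ^ e)) (iota 0 128) ->
  n = r %[mod d] -> v2 (B n) = (Posz e)%:E.
Proof.
move=> lt_e dvd_d /allP check n_mod; apply: v2_B => //; apply/eqP.
apply: (implyP (check (n %% 128) _)); first by rewrite mem_iota ltn_mod.
by rewrite modn_dvdm // n_mod.
Qed.

(** Everything depends only on [a %% 32]: it fixes [4 * a + 2] modulo 128, and it fixes
    [a * (a + 1)] modulo [2 ^ e.+1], a divisor of 32 since [e <= 4]. This leaves 32 residues for
    each of five values of [e]. *)
Lemma v2_B_4aD2 (a e : nat) : e <= 4 ->
  v2 (a * (a + 1)) = (Posz e)%:E -> v2 (B (4 * a + 2)) = (Posz e.+1)%:E.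
Proof.
move=> le_e /v2_eq a_mod; apply: v2_B => //; apply/eqP.
have check : all (fun e => all (fun b =>
    (b * (b + 1) %% 2 ^ e.+1 == 2 ^ e) ==>
    ((B_state (4 * b + 2)).1.1 %% 2 ^ e.+2 == 2 ^ e.+1)) (iota 0 32)) (iota 0 5).
  by vm_compute.
have dvd_e : 2 ^ e.+1 %| 32 by rewrite (@dvdn_exp2l 2 _ 5).
have -> : (4 * a + 2) %% 128 = 4 * (a %% 32) + 2 by lia.
have {}check := allP check e; rewrite mem_iota in check.
have {check} := allP (check le_e) (a %% 32).
rewrite mem_iota ltn_mod => /(_ isT)/implyP; apply.
by rewrite -modnMm -(modnDml (a %% 32)) modn_dvdm // modnDml modnMm a_mod.
Qed.

Theorem theorem10 (n : nat) :
  (n = 0 %[mod 4] -> v2 (B n) = 0%:E) /\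
  (n = 5 %[mod 8] -> v2 (B n) = 1%:E) /\
  (n = 9 %[mod 16] -> v2 (B n) = 3%:E) /\
  (forall a : nat, n = 4 * a + 2 -> (v2 (a * (a + 1)) <= 4%:E)%E ->
     v2 (B n) = (1%:E + v2 (a * (a + 1)))%E) /\
  (n = 3 %[mod 4] -> v2 (B n) = 0%:E).
Proof.
split; first by apply: v2_B_class; vm_compute.
split; first by apply: v2_B_class; vm_compute.
split; first by apply: v2_B_class; vm_compute.
split; last by apply: v2_B_class; vm_compute.
move=> a ->.
(* The infinite value, taken at [a = 0], contradicts the bound by 4. *)
have [-> // | [e v2_a]] : v2 (a * (a + 1)) = +oo%E \/
    exists e : nat, v2 (a * (a + 1)) = (Posz e)%:E.
  by rewrite /v2; case: ifP; [left | right; eexists].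
by rewrite v2_a lee_fin => le_e; rewrite (v2_B_4aD2 _ _ le_e v2_a) -EFinD.
Qed.
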